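(* Let $k>2$ and $2k<n+2$, and let $\mathcal F_1,\dots,\mathcal F_k$ be families of convex compact sets in $\mathbb R^n$. Suppose that for some positive integer $m\le n-k+1$ the inequality $$2^{\lceil\log_2 n\rceil}\ge k\,2^{\lceil\log_2(n-m)\rceil}+2$$ holds. Then at least one of the following holds: 1) there exist representatives $K_1\in\mathcal F_1,\dots,K_k\in\mathcal F_k$ with $\bigcap_{i=1}^kK_i=\emptyset$; 2) for some $i$, any $m+1$ or fewer sets of $\mathcal F_i$ have a common $(m-1)$-transversal.
   Context: A $j$-flat is a $j$-dimensional affine subspace of $\mathbb R^n$; it is a common $j$-transversal of a family of sets if it intersects every set of the family. *)

(* Defs.v *)
From mathcomp Require Import all_boot all_order all_algebra.
From mathcomp Require Import all_classical all_reals all_analysis.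

Set Implicit Arguments.
Unset Strict Implicit.
Unset Printing Implicit Defensive.

Import Order.TTheory GRing.Theory Num.Theory.
Import numFieldNormedType.Exports.

Local Open Scope classical_set_scope.
Local Open Scope ring_scope.

Definition flat (R : realType) (n j : nat) (L : set 'rV[R]_n) : Prop :=
  exists (p : 'rV[R]_n) (V : {vspace 'rV[R]_n}),
    \dim V = j /\ L = [set p + v | v in [set` V]].

Definition has_common_transversal (R : realType) (n j : nat)
    (G : set (set 'rV[R]_n)) : Prop :=
  exists2 L : set 'rV[R]_n,
    flat j L & forall K, G K -> L `&` K !=set0.

(* Main.v *)
Require Import Defs.
From mathcomp Require Import all_boot all_order all_algebra.
From mathcomp Require Import all_classical all_reals all_analysis.
From mathcomp Require Import ring lra zify.
Set Implicit Arguments.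
Unset Strict Implicit.
Unset Printing Implicit Defensive.
Import Order.TTheory GRing.Theory Num.Theory.
Import numFieldNormedType.Exports.
Local Open Scope card_scope.
Local Open Scope ring_scope.

(* The inequality between powers of 2 and [2 < k] give [n < 2 m], and then two
   families are enough. Suppose that [K_0, ..., K_m] in the first family and
   [K'_0, ..., K'_m] in the second one have no common [(m - 1)]-transversal, and
   choose [x_ij] in [K_i] and [K'_j]. Points of the [K_i] are then affinely
   independent, so by Gordan's theorem every bipartition of the rows of [x] is
   strictly separated by a linear form; likewise for the columns. Interpolating
   these forms over the barycentric subdivisions of two spheres of dimension
   [m - 1] gives an odd map from the join of these spheres, of dimension
   [2 m - 1], to the space of linear forms, of dimension [n < 2 m]. By the
   Borsuk-Ulam theorem it vanishes somewhere: some linear form separates two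
   rows [i], [i'] while its opposite weakly separates two columns [j], [j'], which
   is contradictory at the entries [(i, j)] and [(i', j')].

   For such a piecewise linear map the Borsuk-Ulam theorem has a combinatorial
   proof: after a perturbation to general position, the number of simplices of
   the [j]-dimensional hemisphere whose image under the first [j] coordinates
   contains the origin is odd, by induction on [j]. *)

(** * Gordan's theorem *)

Lemma small_perturbation (R : realFieldType) (I : eqType) (r : seq I)
    (a b : I -> R) :
  (forall i, i \in r -> 0 < a i) ->
  exists2 e : R, 0 < e &
    forall t, 0 < t < e -> forall i, i \in r -> 0 < a i + t * b i.
Proof.
elim: r => [|x r IHr] a_gt0; first by exists 1.
have [i ri|e e_gt0 He] := IHr; first by rewrite a_gt0 // in_cons ri orbT.
have ax := a_gt0 x (mem_head _ _).
have nb : 0 < `|b x| + 1 by rewrite ltr_wpDl.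
exists (Num.min e (a x / (`|b x| + 1))).
  by rewrite lt_min e_gt0 divr_gt0.
move=> t /andP[t0]; rewrite lt_min ltr_pdivlMr // => /andP[te tax] i.
rewrite in_cons => /orP[/eqP->|ri]; last by apply: He => //; rewrite t0.
have : - (t * `|b x|) <= t * b x.
  by rewrite -mulrN ler_pM2l // lerNl -normrN ler_norm.
nra.
Qed.

(** Induction on [r]. A form [l] found for the tail may fail to be positive at the new vector [a x];
    the induction hypothesis is then applied again, to combinations of the [a i] and [a x] that lie
    in the kernel of [l]. *)
Lemma gordan_seq (R : realFieldType) (I T : finType) (r : seq I)
    (a : I -> T -> R) :
  (exists l : T -> R, forall i, i \in r -> 0 < \sum_k l k * a i k)
  \/ (exists c : I -> R, [/\ forall i, 0 <= c i, forall i, i \notin r -> c i = 0,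
        exists i, 0 < c i & forall k, \sum_i c i * a i k = 0]).
Proof.
elim: r a => [|x r IHr] a; first by left; exists (fun=> 0).
case: (boolP (x \in r)) => [xr|xNr].
  case: (IHr a) => [[l Hl]|[c [c0 cr ci cs]]].
    by left; exists l => i; rewrite in_cons => /orP[/eqP->|]; apply: Hl.
  right; exists c; split => // i; rewrite in_cons negb_or => /andP[_ ]; exact: cr.
case: (IHr a) => [[l Hl]|[c [c0 cr ci cs]]]; last first.
  right; exists c; split => // i; rewrite in_cons negb_or => /andP[_ ]; exact: cr.
pose ev (u : T -> R) i := \sum_k u k * a i k.
have [lx|lx] := ltP 0 (ev l x).
  by left; exists l => i; rewrite in_cons => /orP[/eqP->|]; [|apply: Hl].
pose c := - ev l x; have c_ge0 : 0 <= c by rewrite oppr_ge0.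
(* Since [c = - ev l x], the form [l] vanishes at these combinations. A positive relation [mu]
   between them unfolds into one between the [a i] and [a x]. *)
case: (IHr (fun i k => c * a i k + ev l i * a x k)) => [[l' Hl']|]; last first.
  move=> [mu [mu0 mur [i0 mui0] mus]]; right.
  have i0r : i0 \in r.
    by apply/negPn/negP => /mur E; rewrite E ltxx in mui0.
  have mux : mu x = 0 by apply: mur.
  exists (fun i => if i == x then \sum_i mu i * ev l i else c * mu i).
  have Mx : 0 < \sum_i mu i * ev l i.
    rewrite (bigD1 i0) //= ltr_wpDr //; last by rewrite mulr_gt0 // Hl.
    apply: sumr_ge0 => i _; case: (boolP (i \in r)) => [ir|/mur->].
      by rewrite mulr_ge0 // ltW // Hl.
    by rewrite mul0r.
  split.
  - by move=> i; case: ifP => _; [exact: ltW|rewrite mulr_ge0].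
  - move=> i; rewrite in_cons negb_or => /andP[/negPf-> /mur->]; by rewrite mulr0.
  - by exists x; rewrite eqxx.
  - move=> k; rewrite (bigD1 x) //= eqxx mulr_suml.
    rewrite [X in _ + X](eq_bigr (fun i => c * mu i * a i k)); last first.
      by move=> i /negPf->.
    have -> : \sum_(i | i != x) c * mu i * a i k = \sum_i c * mu i * a i k.
      by rewrite [RHS](bigD1 x) //= mux mulr0 mul0r add0r.
    by apply/etrans/(mus k); rewrite -big_split /=; apply: eq_bigr => i _; ring.
have [ax|/existsPn ax] := boolP [exists k, a x k != 0]; last first.
  right; exists (fun i => (i == x)%:R); split.
  - by move=> i; rewrite ler0n.
  - by move=> i; rewrite in_cons negb_or => /andP[/negPf->].
  - by exists x; rewrite eqxx ltr01.
  - move=> k; rewrite (bigD1 x) //= eqxx mul1r (eqP (negPn (ax k))) add0r.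
    by rewrite big1 // => i /negPf->; rewrite mul0r.
(* [m] vanishes at [x] and is positive on [r]; tilting it slightly towards [a x] makes it positive
   at [x] too. *)
pose m k := c * l' k + ev l' x * l k.
have evm i : ev m i = c * ev l' i + ev l' x * ev l i.
  rewrite /m; move: (c) (ev l' x) => c1 c2.
  rewrite /ev !mulr_sumr -big_split /=; by apply: eq_bigr => k _; ring.
have mx : ev m x = 0 by rewrite evm /c; ring.
have m_gt0 i : i \in r -> 0 < ev m i.
  move=> /Hl' H; rewrite evm.
  suff -> : c * ev l' i + ev l' x * ev l i =
      \sum_k l' k * (c * a i k + ev l i * a x k) by [].
  move: (c) (ev l i) => c1 c2; rewrite /ev mulr_sumr mulr_suml -big_split /=.
  by apply: eq_bigr => k _; ring.
have [e e0 He] := small_perturbation (ev (a x)) m_gt0.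
left; exists (fun k => m k + e / 2 * a x k) => i.
have -> : \sum_k (m k + e / 2 * a x k) * a i k = ev m i + e / 2 * ev (a x) i.
  by rewrite /ev mulr_sumr -big_split /=; apply: eq_bigr => k _; ring.
rewrite in_cons => /orP[/eqP->|ir]; last by apply: He => //; lra.
rewrite mx add0r mulr_gt0 //; first lra.
have /existsP[k0 ak0] := ax.
rewrite /ev (bigD1 k0) //= ltr_wpDr //.
  by apply: sumr_ge0 => k _; rewrite -expr2 sqr_ge0.
by rewrite -expr2 lt_neqAle sqr_ge0 eq_sym sqrf_eq0 ak0.
Qed.

Lemma gordan (R : realFieldType) (I T : finType) (a : I -> T -> R) :
  (exists l : T -> R, forall i, 0 < \sum_k l k * a i k)
  \/ (exists c : I -> R, [/\ forall i, 0 <= c i,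
        exists i, 0 < c i & forall k, \sum_i c i * a i k = 0]).
Proof.
have [[l Hl]|[c [c0 _ ci cs]]] := gordan_seq (enum I) a.
  by left; exists l => i; apply: Hl; rewrite mem_enum.
by right; exists c.
Qed.

(** * Simplices in general position *)

(* The summand of index [i] says that the zero of [a i + t * b i] is an endpoint
   of the interval [{t | forall i', 0 <= a i' + t * b i'}]: an interval bounded
   on one side only has one endpoint, a bounded or empty one has two or none. *)
Lemma endpoint_parity (R : realFieldType) (I : finType) (i0 : I) (a b : I -> R) :
  (forall i, b i != 0) -> 0 < b i0 ->
  (forall i i', i != i' -> a i / b i != a i' / b i') ->
  [forall i, 0 < b i] =
  \big[addb/false]_i [forall i', 0 <= a i' - a i / b i * b i'].
Proof.
move=> b0 bi0 qI; pose q i := a i / b i.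
have cE i i' : (0 <= a i' - a i / b i * b i') =
    if 0 < b i' then q i <= q i' else q i' <= q i.
  have -> : a i' - a i / b i * b i' = b i' * (q i' - q i).
    by rewrite /q mulrBr mulrCA divff ?mulr1 // [b i' * _]mulrC.
  case: (ltrP 0 (b i')) => bi'; first by rewrite pmulr_rge0 // subr_ge0.
  have bi'_lt0 : b i' < 0 by rewrite lt_neqAle b0.
  by rewrite nmulr_rge0 // subr_le0.
have q_inj i i' : q i = q i' -> i = i'.
  by move=> qE; apply/eqP/negP => /negP /qI; rewrite -/(q i) -/(q i') qE eqxx.
pose good i := [forall i', 0 <= a i' - a i / b i * b i'].
have goodP i : reflect (forall i', if 0 < b i' then q i <= q i' else q i' <= q i)
    (good i).
  by apply: (iffP forallP) => H i'; move: (H i'); rewrite cE.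
have [p bp p_min] : exists2 p, 0 < b p & forall i, 0 < b i -> q p <= q i.
  by case: (arg_minP (P := fun i => 0 < b i) q bi0) => p bp H; exists p.
have good_pos i : good i -> 0 < b i -> i = p.
  move=> /goodP Hg bi; apply: q_inj; apply/eqP; rewrite eq_le p_min // andbT.
  by have := Hg p; rewrite bp.
case: (boolP [forall i, 0 < b i]) => [/forallP b_gt0|].
  have gp : good p by apply/goodP => i; rewrite b_gt0 p_min.
  rewrite (bigD1 p) //= -/(good p) gp big1 // => i ip.
  by apply/negP => /good_pos => /(_ (b_gt0 i)) E; rewrite E eqxx in ip.
rewrite negb_forall => /existsP[n0 bn0].
have [n bn n_max] : exists2 n, ~~ (0 < b n) & forall i, ~~ (0 < b i) -> q i <= q n.
  by case: (arg_maxP (P := fun i => ~~ (0 < b i)) q bn0) => n bn H; exists n.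
have good_neg i : good i -> ~~ (0 < b i) -> i = n.
  move=> /goodP Hg bi; apply: q_inj; apply/eqP; rewrite eq_le n_max //=.
  by have := Hg n; rewrite (negPf bn).
have np : n != p by apply: contraNneq bn => ->.
(* Only [p] and [n] can be endpoints. Both are when [q n <= q p], and neither is otherwise, so their
   terms cancel. *)
rewrite (bigD1 p) //= (bigD1 n) //= -/(good p) -/(good n) big1 => [|i /andP[ip iN]].
  rewrite addbF; suff -> : good p = good n by rewrite addbb.
  apply/goodP/goodP => H i.
    case: ifPn => [bi|/n_max //].
    by apply: le_trans (p_min _ bi); have := H n; rewrite (negPf bn).
  case: ifPn => [/p_min //|bi].
  by apply: le_trans (n_max _ bi) _; have := H p; rewrite bp.
apply/negP => gi; case: (boolP (0 < b i)) => [/(good_pos _ gi)|/(good_neg _ gi)] E.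
  by rewrite E eqxx in ip.
by rewrite E eqxx in iN.
Qed.

(* Points are sequences [nat -> R], so that the same simplex can be looked at in
   its projections to the first [j] coordinates, for varying [j]. *)
Definition comb (R : realFieldType) n (w : nat -> nat -> R) (l : nat -> R) k : R :=
  \sum_(i < n) l i * w i k.

(** There are as many coordinates as vectors: a square block of [w] is invertible. General position
    takes this form below. *)
Definition indep (R : realFieldType) n (w : nat -> nat -> R) : Prop :=
  forall l, (forall k, (k < n)%N -> comb n w l k = 0) ->
    forall i, (i < n)%N -> l i = 0.

(** The weights are taken up to scaling: not all zero, instead of summing to 1. *)
Definition hits_origin (R : realFieldType) j n (w : nat -> nat -> R) : Prop :=
  exists l, [/\ forall i, (i < n)%N -> 0 <= l i,
    exists2 i, (i < n)%N & 0 < l i & forall k, (k < j)%N -> comb n w l k = 0].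

Definition hits_ray (R : realFieldType) j n (w : nat -> nat -> R) : Prop :=
  exists l, [/\ forall i, (i < n)%N -> 0 <= l i,
    forall k, (k < j)%N -> comb n w l k = 0 & 0 < comb n w l j].

Section Comb.
Variable R : realFieldType.
Implicit Types (w : nat -> nat -> R) (l : nat -> R).

Lemma combD n w l l' (a b : R) k :
  comb n w (fun i => a * l i + b * l' i) k = a * comb n w l k + b * comb n w l' k.
Proof.
rewrite /comb !mulr_sumr -big_split; apply: eq_bigr => i _ /=.
by rewrite mulrDl !mulrA.
Qed.

Lemma combN n w l k :
  comb n (fun i k => - w i k) l k = - comb n w l k.
Proof. by rewrite /comb -sumrN; apply: eq_bigr => i _; rewrite mulrN. Qed.

Lemma comb_bump n w l i k : (i < n.+1)%N ->
  comb n.+1 w l k = l i * w i k + comb n (w \o bump i) (l \o bump i) k.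
Proof.
by move=> lt_i; rewrite /comb (bigD1_ord (Ordinal lt_i)).
Qed.

Lemma coef_gt0_of_comb n w l k : (forall i, (i < n)%N -> 0 <= l i) ->
  (0 < comb n w l k) -> exists2 i, (i < n)%N & 0 < l i.
Proof.
move=> l0 c_gt0; apply/not_exists2P => H.
suff c0 : comb n w l k = 0 by rewrite c0 ltxx in c_gt0.
rewrite /comb big1 // => i _; have [/(_ (ltn_ord i))//|/negP] := H i.
by rewrite lt_neqAle l0 // andbT negbK => /eqP <-; rewrite mul0r.
Qed.

Lemma bump_unbump i i' : i' != i -> bump i (unbump i i') = i'.
Proof. by move=> ii'; apply: unbumpK; rewrite !inE. Qed.

Lemma unbump_lt n i i' : (i < n.+1)%N -> (i' < n.+1)%N -> i' != i ->
  (unbump i i' < n)%N.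
Proof. by rewrite /unbump; lia. Qed.

Lemma bump_lt n i r : (r < n)%N -> (bump i r < n.+1)%N.
Proof. by rewrite /bump; lia. Qed.

Lemma indep_zero1 n w l i : (i < n.+1)%N -> indep n (w \o bump i) ->
  (forall k, (k < n)%N -> comb n.+1 w l k = 0) -> l i = 0 ->
  forall i', (i' < n.+1)%N -> l i' = 0.
Proof.
move=> lt_i ind_i l0 li i' lt_i'; have [->//|ii'] := eqVneq i' i.
rewrite -(bump_unbump ii').
apply: (ind_i (l \o bump i)); last exact: unbump_lt.
by move=> k /l0; rewrite (comb_bump _ _ _ lt_i) li mul0r add0r.
Qed.

Lemma indep_span n w (c : nat -> R) : indep n w ->
  exists l, forall k, (k < n)%N -> comb n w l k = c k.
Proof.
move=> ind_w; pose M : 'M[R]_n := \matrix_(i, k) w i k.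
pose ext (u : 'rV[R]_n) (i : nat) : R := oapp (u 0) 0 (insub i).
have extE u (i : 'I_n) : ext u i = u 0 i by rewrite /ext valK.
have combE u (k : 'I_n) : comb n w (ext u) k = (u *m M) 0 k.
  by rewrite mxE; apply: eq_bigr => i _; rewrite extE mxE.
have Mu : M \in unitmx.
  rewrite -row_free_unit -kermx_eq0; apply/eqP/row_matrixP => i.
  apply/rowP => k; rewrite row0 [RHS]mxE -extE.
  apply: ind_w (ltn_ord k) => k' lt_k'.
  rewrite (combE _ (Ordinal lt_k')); apply/eqP.
  by rewrite -row_mul mulmx_ker row0 mxE.
exists (ext ((\row_k c k) *m invmx M)) => k lt_k.
by rewrite (combE _ (Ordinal lt_k)) -mulmxA mulVmx // mulmx1 mxE.
Qed.

(** By independence, a nonzero relation in the first [j] coordinates has a nonzero coordinate [j],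
    whose sign chooses the ray. Hitting both rays would give a nonnegative nonzero combination that
    also cancels coordinate [j]. *)
Lemma hits_origin_split j w : indep j.+1 w ->
  `[< hits_origin j j.+1 w >] =
  `[< hits_ray j j.+1 w >] (+) `[< hits_ray j j.+1 (fun i k => - w i k) >].
Proof.
move=> ind_w.
have ray_origin (v : nat -> nat -> R) : hits_ray j j.+1 v -> hits_origin j j.+1 v.
  move=> [l [l0 lk lj]]; exists l; split => //; exact: (coef_gt0_of_comb l0 lj).
have nboth : hits_ray j j.+1 w -> hits_ray j j.+1 (fun i k => - w i k) -> False.
  move=> [l [l0 lk lj]] [l' [l'0 l'k]]; rewrite combN oppr_gt0 => l'j.
  have [i lt_i li] := coef_gt0_of_comb l0 lj.
  pose g i := - comb j.+1 w l' j * l i + comb j.+1 w l j * l' i.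
  have gk k : (k < j.+1)%N -> comb j.+1 w g k = 0.
    rewrite ltnS leq_eqVlt combD => /orP[/eqP->|lt_k]; first by ring.
    have := l'k _ lt_k; rewrite combN lk // => /eqP; rewrite oppr_eq0 => /eqP->.
    by ring.
  have /eqP := ind_w g gk i lt_i; rewrite /g paddr_eq0.
  - by rewrite !mulf_eq0 oppr_eq0 (lt_eqF l'j) (gt_eqF li).
  - by rewrite mulr_ge0 ?l0 // oppr_ge0 ltW.
  - by rewrite mulr_ge0 ?l'0 // ltW.
case: (pselect (hits_origin j j.+1 w)) => [ho|nho]; last first.
  have nr : ~ hits_ray j j.+1 w by apply: contra_not nho; exact: ray_origin.
  have nr' : ~ hits_ray j j.+1 (fun i k => - w i k).
    apply: contra_not nho => /ray_origin [l [l0 li lk]]; exists l; split => //.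
    by move=> k /lk; rewrite combN => /eqP; rewrite oppr_eq0 => /eqP.
  by rewrite (asboolF nho) (asboolF nr) (asboolF nr').
rewrite (asboolT ho); have [l [l0 [i lt_i li] lk]] := ho.
have [lj|lj|lj] := ltgtP (comb j.+1 w l j) 0.
- have hr : hits_ray j j.+1 (fun i k => - w i k).
    exists l; split => //; last by rewrite combN oppr_gt0.
    by move=> k /lk; rewrite combN => ->; rewrite oppr0.
  by rewrite [in RHS](asboolT hr) asboolF // => /nboth; apply.
- have hr : hits_ray j j.+1 w by exists l.
  by rewrite [in RHS](asboolT hr) asboolF // => /(nboth hr).
- have := ind_w l; rewrite (_ : l i = 0) ?ltxx // in li.
  apply: ind_w lt_i => k; rewrite ltnS leq_eqVlt => /orP[/eqP->//|]; exact: lk.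
Qed.

(* The solutions [l] of [comb j.+2 w l k = 0] for [k < j], [comb j.+2 w l j = 1]
   form a line; its nonnegative part is an interval, whose endpoints are the
   facets that hit the ray, and which is unbounded on one side exactly when the
   direction of the line, the linear relation between the [w i], has a constant
   sign. *)
Lemma hits_origin_boundary j w :
  (forall i, (i < j.+2)%N -> indep j.+1 (w \o bump i)) ->
  (forall i i', (i < j.+2)%N -> (i' < j.+1)%N -> indep j (w \o bump i \o bump i')) ->
  `[< hits_origin j.+1 j.+2 w >] =
  \big[addb/false]_(i < j.+2) `[< hits_ray j j.+1 (w \o bump i) >].
Proof.
move=> ind1 ind2.
have zero1 l i : (i < j.+2)%N -> l i = 0 ->
    (forall k, (k < j.+1)%N -> comb j.+2 w l k = 0) ->
    forall i', (i' < j.+2)%N -> l i' = 0.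
  by move=> lt_i li lk; apply: (indep_zero1 lt_i (ind1 _ lt_i) lk li).
pose cons0 (c : R) (m : nat -> R) i := if i is i'.+1 then m i' else c.
have combS c m k : comb j.+2 w (cons0 c m) k = c * w 0%N k + comb j.+1 (w \o bump 0) m k.
  by rewrite (@comb_bump _ _ _ 0%N).
(* [b] is the linear relation between the [w i], scaled so that [b 0 = 1]; [a] is the point of the
   solution line with [a 0 = 0]. *)
have [b0 Hb0] := indep_span (fun k => - w 0%N k) (ind1 0%N isT).
have [a0 Ha0] := indep_span (fun k => (k == j)%:R) (ind1 0%N isT).
pose b := cons0 1 b0; pose a := cons0 0 a0.
have bk k : (k < j.+1)%N -> comb j.+2 w b k = 0.
  by move=> lt_k; rewrite combS Hb0 // mul1r subrr.
have ak k : (k < j.+1)%N -> comb j.+2 w a k = (k == j)%:R.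
  by move=> lt_k; rewrite combS Ha0 // mul0r add0r.
have b_neq0 (i : 'I_j.+2) : b i != 0.
  apply/eqP => bi; have : b 0%N = 0 by apply: (zero1 b i).
  by move=> /eqP; rewrite oner_eq0.
have gE (i : 'I_j.+2) k : (k < j.+1)%N ->
    comb j.+2 w (fun i' => 1 * a i' + (- (a i / b i)) * b i') k = (k == j)%:R.
  by move=> lt_k; rewrite combD ak // bk // mul1r mulr0 addr0.
have gi (i : 'I_j.+2) : 1 * a i + (- (a i / b i)) * b i = 0.
  by rewrite mul1r mulNr divfK ?subrr.
(* A common endpoint for [i] and [i'] would be a solution supported on [j] vectors that are
   independent in the first [j] coordinates; it would vanish, against its value 1 in coordinate
   [j]. *)
have q_inj (i i' : 'I_j.+2) : i != i' -> a i / b i != a i' / b i'.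
  move=> ii'; apply/eqP => qE.
  have g' := gi i'; rewrite -qE in g'.
  have gk := gE i; have g := gi i.
  set gm := fun _ => _ in g g' gk.
  have i'i : (i' : nat) != i by rewrite eq_sym.
  have lt_u := unbump_lt (ltn_ord i) (ltn_ord i') i'i.
  suff H : forall r, (r < j.+2)%N -> gm r = 0.
    have := gk j (leqnn _); rewrite eqxx /comb big1 => [/esym/eqP|r _].
      by rewrite oner_eq0.
    by rewrite [gm _]H ?mul0r.
  move=> r lt_r; have [->|ri] := eqVneq r i; first exact: g.
  rewrite -(bump_unbump ri).
  apply: (@indep_zero1 j (w \o bump i) (gm \o bump i) _ lt_u (ind2 _ _ _ lt_u)) => //=.
  - move=> k lt_k; have := gk k (ltnW lt_k).
    rewrite (comb_bump _ _ _ (ltn_ord i)) [gm i]g mul0r add0r => ->.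
    by rewrite (ltn_eqF lt_k).
  - by rewrite bump_unbump.
  - exact: unbump_lt.
(* Every relation [l] is [l 0] times [b], and [b] has no zero entry. *)
transitivity [forall i : 'I_j.+2, 0 < b i].
  apply/asboolP/forallP => [[l [l0 [i lt_i li] lk]] i'|b_gt0]; last first.
    exists b; split => //.
    - by move=> i lt_i; rewrite ltW // (b_gt0 (Ordinal lt_i)).
    - by exists 0%N.
  have lE r : (r < j.+2)%N -> 1 * l r + (- l 0%N) * b r = 0.
    apply: (@zero1 (fun r => 1 * l r + (- l 0%N) * b r) 0%N) => //.
      by rewrite /= mul1r mulr1 subrr.
    by move=> k lt_k; rewrite combD lk // bk // !mulr0 addr0.
  have l0_gt0 : 0 < l 0%N.
    rewrite lt_neqAle l0 // andbT eq_sym; apply/eqP => l00.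
    have := lE _ lt_i; rewrite l00 mul1r oppr0 mul0r addr0 => E.
    by rewrite E ltxx in li.
  rewrite lt_neqAle eq_sym b_neq0 /= -(pmulr_rge0 _ l0_gt0).
  have := lE _ (ltn_ord i'); rewrite mul1r mulNr => /eqP.
  by rewrite subr_eq0 => /eqP <-; apply: l0.
rewrite (@endpoint_parity R _ ord0 (a \o val) (b \o val)) //=.
apply: eq_bigr => i _; apply/forallP/asboolP => [H|[l [l0 lk lj]] i'].
  pose gm r := 1 * a r + (- (a i / b i)) * b r.
  have cE k : comb j.+1 (w \o bump i) (gm \o bump i) k = comb j.+2 w gm k.
    by rewrite (comb_bump _ _ _ (ltn_ord i)) [gm i]gi mul0r add0r.
  exists (gm \o bump i); split.
  - move=> r /(bump_lt i) lt_r; have := H (Ordinal lt_r).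
    by rewrite /gm /= mul1r mulNr.
  - by move=> k lt_k; rewrite cE (gE _ _ (leqW lt_k)) (ltn_eqF lt_k).
  - by rewrite cE gE // eqxx ltr01.
(* A hit of the ray by the facet [i], rescaled to value 1 and extended by 0 at [i], is the endpoint
   of index [i] by uniqueness. *)
pose l' r := if r == i :> nat then 0 else l (unbump i r) / comb j.+1 (w \o bump i) l j.
have l'c k : comb j.+2 w l' k = comb j.+1 (w \o bump i) l k / comb j.+1 (w \o bump i) l j.
  rewrite (comb_bump _ _ _ (ltn_ord i)) /l' eqxx mul0r add0r /comb mulr_suml.
  apply: eq_bigr => r _ /=; rewrite eq_sym (negPf (neq_bump _ _)) bumpK.
  by rewrite mulrAC.
have l'0 r : (r < j.+2)%N -> 0 <= l' r.
  move=> lt_r; rewrite /l'; case: eqVneq => // ri.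
  by rewrite divr_ge0 ?l0 ?unbump_lt // ltW.
suff : 1 * l' i' + (-1) * (1 * a i' + (- (a i / b i)) * b i') = 0.
  rewrite !mul1r mulN1r mulNr => /eqP; rewrite subr_eq0 => /eqP <-; exact: l'0.
apply: (@zero1 (fun r => 1 * l' r + (-1) * (1 * a r + (- (a i / b i)) * b r)) i) => //.
  by rewrite gi /l' eqxx !mulr0 addr0.
move=> k lt_k; rewrite combD gE // l'c mul1r mulN1r.
move: lt_k; rewrite ltnS leq_eqVlt => /orP[/eqP->|lt_k].
  by rewrite eqxx divff ?subrr // gt_eqF.
by rewrite lk // (ltn_eqF lt_k) mul0r subrr.
Qed.
End Comb.

(** * Barycentric subdivision of the cross-polytope *)

(** The two orders of an unordered pair cancel modulo 2. *)
Lemma addb_big_sym (I : finType) (P : pred I) (F : I -> I -> bool) :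
  (forall i j, F i j = F j i) ->
  \big[addb/false]_(i | P i) \big[addb/false]_(j | P j && (j != i)) F i j = false.
Proof.
move=> symF; pose lt (i j : I) := (enum_rank i < enum_rank j)%N.
have nltP i j : j != i -> ~~ lt j i = lt i j.
  by move=> /negPf ij; rewrite -leqNgt leq_eqVlt (inj_eq val_inj)
    (inj_eq enum_rank_inj) eq_sym ij.
have lt_neq i j : lt i j -> i != j by apply: contraTneq => ->; rewrite /lt ltnn.
under eq_bigr => i _ do rewrite (bigID (lt^~ i)) /=.
rewrite big_split /=.
have -> : \big[addb/false]_(i | P i)
    \big[addb/false]_(j | (P j && (j != i)) && ~~ lt j i) F i j =
  \big[addb/false]_(i | P i) \big[addb/false]_(j | P j && lt i j) F i j.
  apply: eq_bigr => i Pi; apply: eq_bigl => j.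
  case: (eqVneq j i) => [->|/nltP ->]; last by rewrite andbT.
  by rewrite andbF /lt ltnn andbF.
rewrite [X in _ (+) X](exchange_big_dep P) /=; last by move=> i j _ /andP[].
have addb0 (a b : bool) : a = b -> a (+) b = false by move=> ->; rewrite addbb.
apply: addb0.
apply: eq_bigr => i Pi; apply: eq_big => j; last by rewrite symF.
by rewrite Pi; case: (boolP (lt j i)) => [/lt_neq ->|]; rewrite ?andbT ?andbF.
Qed.

Lemma addb_big_involution (I : finType) (Q p : pred I) (h : I -> I) (G : I -> bool) :
  involutive h -> (forall s, Q (h s) = Q s) -> (forall s, G (h s) = G s) ->
  (forall s, Q s -> p (h s) = ~~ p s) ->
  \big[addb/false]_(s | Q s) G s = false.
Proof.
move=> hK Qh Gh ph; rewrite (bigID p) /= [X in _ (+) X](reindex_inj (inv_inj hK)) /=.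
have addb0 (a b : bool) : a = b -> a (+) b = false by move=> ->; rewrite addbb.
apply: addb0.
apply: eq_big => s; last by rewrite Gh.
by rewrite Qh; case: (boolP (Q s)) => //= /ph ->; rewrite negbK.
Qed.

Section SignVectors.
Variable N : nat.

(* A sign vector is a face of the boundary of the cross-polytope in dimension
   [N]: [None] stands for the coordinate 0. *)
Definition signvec := {ffun 'I_N -> option bool}.
Implicit Types (s t : signvec) (sigma : seq signvec).

Definition zerov : signvec := [ffun=> None].
Definition oppv s : signvec := [ffun i => omap negb (s i)].
Definition setv s i0 b : signvec := [ffun i => if i == i0 then b else s i].
Definition erasev s i0 := setv s i0 None.
Definition supp s : {set 'I_N} := [set i | s i != None].
Definition facev t s := [forall i, (t i == None) || (t i == s i)].
Definition ltv s t := facev t s && (t != s).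
(** The simplices of the barycentric subdivision, larger faces first; [zerov] is the empty face,
    hence not a vertex. *)
Definition chainv sigma := sorted ltv sigma && (zerov \notin sigma).

Lemma oppvK : involutive oppv.
Proof. by move=> s; apply/ffunP => i; rewrite !ffunE; case: (s i) => [[]|]. Qed.

Lemma oppv0 : oppv zerov = zerov.
Proof. by apply/ffunP => i; rewrite !ffunE. Qed.

Lemma oppv_erase s i : oppv (erasev s i) = erasev (oppv s) i.
Proof. by apply/ffunP => k; rewrite !ffunE; case: eqP. Qed.

Lemma supp_oppv s : supp (oppv s) = supp s.
Proof. by apply/setP => i; rewrite !inE ffunE; case: (s i). Qed.

Lemma supp_erasev s i : supp (erasev s i) = supp s :\ i.
Proof. by apply/setP => k; rewrite !inE ffunE; case: (eqVneq k i). Qed.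

Lemma erasevC s i k : erasev (erasev s i) k = erasev (erasev s k) i.
Proof. by apply/ffunP => l; rewrite !ffunE; do 2 case: ifP. Qed.

Lemma facevP t s : reflect (forall i, t i != None -> t i = s i) (facev t s).
Proof.
apply: (iffP forallP) => H i; first by move=> ti; have := H i; rewrite (negPf ti) => /eqP.
by case: eqP => //= /eqP /H ->.
Qed.

Lemma facev_refl s : facev s s. Proof. by apply/facevP. Qed.

Lemma facev_trans s t u : facev s t -> facev t u -> facev s u.
Proof.
move=> /facevP st /facevP tu; apply/facevP => i si.
by rewrite (st _ si) tu // -(st _ si).
Qed.

Lemma facev_anti s t : facev s t -> facev t s -> s = t.
Proof.
move=> /facevP st /facevP ts; apply/ffunP => i.
case: (eqVneq (s i) None) => [si|/st //].
case: (eqVneq (t i) None) => [ti|/ts //]; by rewrite si ti.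
Qed.

Lemma ltv_trans : transitive ltv.
Proof.
move=> t s u /andP[ts nts] /andP[ut nut]; rewrite /ltv (facev_trans ut ts) /=.
by apply: contra nut => /eqP us; rewrite us in ut *; rewrite (facev_anti ut ts).
Qed.

Lemma supp_facev t s : facev t s -> supp t \subset supp s.
Proof.
by move=> /facevP ts; apply/fintype.subsetP => i; rewrite !inE => ti; rewrite -ts.
Qed.

Lemma supp_ltv s t : ltv s t -> (#|supp t| < #|supp s|)%N.
Proof.
move=> /andP[ts nts]; apply: proper_card; rewrite finset.properEneq supp_facev // andbT.
apply: contra nts => /eqP E; apply/eqP/ffunP => i.
case: (eqVneq (t i) None) => [ti|]; last exact: (facevP _ _ ts).
have : i \notin supp s by rewrite -E inE ti.
by rewrite inE negbK ti => /eqP.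
Qed.

Lemma chainv_subseq sigma tau : subseq tau sigma -> chainv sigma -> chainv tau.
Proof.
move=> sub /andP[so z]; rewrite /chainv (subseq_sorted ltv_trans sub) //=.
by apply: contra z; apply: mem_subseq.
Qed.

(* The parity of the number of flags [s_k > ... > s_1] of faces of [s], each
   of codimension 1 in the preceding one and starting with [s], that satisfy
   [f]: these are the maximal simplices of the barycentric subdivision of [s]. *)
Fixpoint flag_sum k s (f : seq signvec -> bool) : bool :=
  if k is k'.+1 then
    \big[addb/false]_(i in supp s) flag_sum k' (erasev s i) (fun sigma => f (s :: sigma))
  else f [::].

(** The coboundary of [f] modulo 2, evaluated at [sigma]. *)
Fixpoint boundary_sum (f : seq signvec -> bool) sigma : bool :=
  if sigma is s :: sigma' then
    f sigma' (+) boundary_sum (fun tau => f (s :: tau)) sigma'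
  else false.

Definition del i sigma := take i sigma ++ drop i.+1 sigma.

Lemma boundary_sumE f sigma :
  boundary_sum f sigma = \big[addb/false]_(i < size sigma) f (del i sigma).
Proof.
elim: sigma f => [|s sigma IHs] f /=; first by rewrite big_ord0.
by rewrite big_ord_recl IHs /del /= drop0.
Qed.

Lemma nth_del i sigma r : (i < size sigma)%N ->
  nth zerov (del i sigma) r = nth zerov sigma (bump i r).
Proof.
move=> lt_i; rewrite nth_cat size_take lt_i /bump; case: (ltnP r i) => r_i /=.
  by rewrite nth_take.
by rewrite nth_drop; congr nth; lia.
Qed.

Lemma del_subseq i sigma : subseq (del i sigma) sigma.
Proof.
rewrite -{2}(cat_take_drop i sigma) cat_subseq //.
by rewrite -addn1 addnC -drop_drop drop_subseq.
Qed.

Lemma size_del i sigma : (i < size sigma)%N -> size (del i sigma) = (size sigma).-1.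
Proof. by move=> lt_i; rewrite size_cat size_take lt_i size_drop; lia. Qed.

Lemma eq_flag_sum k s f g : (k <= #|supp s|)%N ->
  (forall sigma, size sigma = k -> chainv sigma -> f sigma = g sigma) ->
  flag_sum k s f = flag_sum k s g.
Proof.
move=> ks fg; have {fg} : forall sigma, size sigma = k -> chainv sigma ->
  all (facev^~ s) sigma -> f sigma = g sigma by move=> sigma /fg H /H.
elim: k s f g ks => [|k IHk] s f g ks fg /=; first by rewrite fg.
apply: eq_bigr => i si; apply: IHk => [|sigma szs chs als].
  by rewrite supp_erasev; move: ks; rewrite (cardsD1 i) si.
have nzs : s != zerov.
  by apply: contraTneq si => ->; rewrite inE ffunE.
have lts t : facev t (erasev s i) -> ltv s t.
  move=> /facevP H; apply/andP; split.
    apply/facevP => l tl; have := H l tl; rewrite ffunE; case: eqP => // li E.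
    by rewrite E in tl.
  apply: contraTneq si => E; rewrite inE negbK -E; apply/negPn/negP => ti.
  by have := H i ti; rewrite ffunE eqxx => E'; rewrite E' in ti.
have alls : all (ltv s) sigma by apply: sub_all als.
apply: fg; rewrite /= ?szs //; last first.
  by rewrite facev_refl; apply: sub_all alls => t /andP[].
rewrite /chainv /= path_min_sorted // in_cons eq_sym (negPf nzs) /=; exact: chs.
Qed.

Lemma flag_sum_ex k s f : (k <= #|supp s|)%N -> flag_sum k s f ->
  exists sigma, [/\ size sigma = k, chainv sigma & f sigma].
Proof.
move=> ks Ef; apply/not_existsP => H.
have := @eq_flag_sum k s f (fun=> false) ks.
rewrite Ef => E0; suff : flag_sum k s (fun=> false) = false.
  rewrite -E0 // => sigma szs chs; apply/negP => fs; exact: (H sigma).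
elim: (k) s {Ef E0 ks} => [|k' IHk] s //=; exact: big1.
Qed.

Lemma flag_sumD k s f g :
  flag_sum k s (fun sigma => f sigma (+) g sigma) = flag_sum k s f (+) flag_sum k s g.
Proof.
elim: k s f g => [|k IHk] s f g //=.
by rewrite -big_split /=; apply: eq_bigr => i _; rewrite IHk.
Qed.

Lemma flag_sum_opp k s f :
  flag_sum k (oppv s) f = flag_sum k s (fun sigma => f (map oppv sigma)).
Proof.
elim: k s f => [|k IHk] s f //=; rewrite supp_oppv.
by apply: eq_bigr => i _; rewrite -oppv_erase IHk.
Qed.

(* Subdivision commutes with the boundary. *)
Lemma flag_sum_boundary k s f :
  flag_sum k.+1 s (boundary_sum f) =
  \big[addb/false]_(i in supp s) flag_sum k (erasev s i) f.
Proof.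
elim: k s f => [|k IHk] s f.
  by rewrite /=; apply: eq_bigr => i _; rewrite addbF.
rewrite [LHS](_ : _ = \big[addb/false]_(i in supp s) (flag_sum k.+1 (erasev s i) f
   (+) flag_sum k.+1 (erasev s i) (boundary_sum (fun tau => f (s :: tau))))); last first.
  by rewrite [LHS]/=; apply: eq_bigr => i _; rewrite -flag_sumD.
(* The remaining terms keep [s]. Erasing [i] and [i'] in either order gives the same face, so they
   cancel in pairs. *)
rewrite big_split -[RHS]addbF; congr (_ (+) _).
under eq_bigr => i _ do rewrite IHk.
rewrite -[RHS](@addb_big_sym _ (mem (supp s))
  (fun i i' => flag_sum k (erasev (erasev s i) i') (fun tau => f (s :: tau)))).
  apply: eq_bigr => i _; apply: eq_bigl => i'.
  by rewrite supp_erasev !inE andbC.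
by move=> i i'; rewrite erasevC.
Qed.

Arguments flag_sum : simpl never.

Definition full j s := [forall i : 'I_N, (s i != None) == (i < j)%N].
Definition top_pos j s := [forall i : 'I_N, (i == j :> nat) ==> (s i == Some true)].

(** The sphere of index [j] has dimension [j - 1]; the hemisphere of index [j] has dimension [j] and
    is positive in coordinate [j], counted from 0. *)
Definition sphere_sum j f := \big[addb/false]_(s | full j s) flag_sum j s f.
Definition hemisphere_sum j f :=
  \big[addb/false]_(s | full j.+1 s && top_pos j s) flag_sum j.+1 s f.

Lemma fullP j s : reflect (forall i : 'I_N, (s i != None) = (i < j)%N) (full j s).
Proof. by apply: (iffP forallP) => H i; [rewrite (eqP (H i))|rewrite H]. Qed.

Lemma card_full j s : (j <= N)%N -> full j s -> #|supp s| = j.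
Proof.
move=> jN /fullP fs; have wI : injective (widen_ord jN).
  by move=> a b /(congr1 val) /= /val_inj.
rewrite -[RHS]card_ord -(card_imset _ wI).
apply: eq_card => i; rewrite inE fs; apply/idP/imsetP => [ij|[k _ ->]]; last exact: (ltn_ord k).
by exists (Ordinal ij) => //; apply: val_inj.
Qed.

(** Erasing coordinate [j] gives each facet of the equator once. A face obtained by erasing some
    [i < j] comes from two facets, which differ in the sign at [i], and cancels. *)
Lemma hemisphere_boundary j f : (j < N)%N ->
  hemisphere_sum j (boundary_sum f) = sphere_sum j f.
Proof.
move=> jN; pose io := Ordinal jN.
rewrite /hemisphere_sum; under eq_bigr => s _ do rewrite flag_sum_boundary.
rewrite (exchange_big_dep (fun i : 'I_N => (i <= j)%N)) /=; last first.
  by move=> s i /andP[/fullP fs _]; rewrite inE fs.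
rewrite (bigD1 io) //= [X in _ (+) X]big1 ?addbF => [|i /andP[ij iio]].
  rewrite /sphere_sum [RHS](reindex_onto (fun s => erasev s io)
    (fun t => setv t io (Some true))) /=; last first.
    move=> t /fullP ft; apply/ffunP => i; rewrite !ffunE; case: eqP => // ->.
    by have := ft io; rewrite ltnn; case: (t io).
  apply: eq_bigl => s; apply/andP/andP => [[/andP[/fullP fs /forallP ts] _]|].
    have tio : s io = Some true by apply/eqP; have := ts io; rewrite eqxx.
    split; last first.
      by apply/eqP/ffunP => i; rewrite !ffunE; case: eqP => // ->.
    apply/fullP => i; rewrite ffunE; case: (eqVneq i io) => [->|ni]; first by rewrite ltnn.
    by rewrite fs ltnS leq_eqVlt; move: ni; rewrite -val_eqE /= => /negPf->.
  move=> [/fullP fs /eqP <-].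
  have H : full j.+1 (setv (erasev s io) io (Some true)).
    apply/fullP => i; rewrite !ffunE.
    case: (eqVneq i io) => [->|ni]; first by rewrite /= ltnSn.
    rewrite ltnS leq_eqVlt; have := fs i; rewrite ffunE (negPf ni) => ->.
    by move: ni; rewrite -val_eqE /= => /negPf->.
  split; last by rewrite inE (fullP _ _ H) /=.
  rewrite H; apply/forallP => i; apply/implyP => /eqP ij.
  by rewrite ffunE -val_eqE /= ij eqxx.
pose Q s := (full j.+1 s && top_pos j s) && (i \in supp s).
apply: (@addb_big_involution _ Q (fun s => s i == Some true)
  (fun s => setv s i (omap negb (s i)))).
- move=> s; apply/ffunP => k; rewrite !ffunE eqxx.
  by case: eqP => // ->; case: (s i) => [[]|].
- move=> s.
  have E k : (setv s i (omap negb (s i)) k != None) = (s k != None).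
    by rewrite ffunE; case: (eqVneq k i) => //= ->; case: (s i).
  rewrite /Q !inE E; congr (_ && _ && _).
    by apply: eq_forallb => k; rewrite E.
  apply: eq_forallb => k; rewrite ffunE; case: (eqVneq k i) => // ->.
  by move: iio; rewrite -val_eqE /= => /negPf->.
- move=> s; congr flag_sum; apply/ffunP => k; rewrite !ffunE.
  by case: eqP.
- by move=> s /andP[_]; rewrite inE ffunE eqxx; case: (s i) => [[]|].
Qed.

Lemma sphere_hemisphere j f : (j < N)%N ->
  sphere_sum j.+1 f =
  hemisphere_sum j f (+) hemisphere_sum j (fun sigma => f (map oppv sigma)).
Proof.
move=> jN; pose io := Ordinal jN.
have topE s : top_pos j s = (s io == Some true).
  apply/forallP/eqP => [/(_ io)|sio i]; first by rewrite eqxx => /eqP.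
  by apply/implyP => /eqP ij; rewrite -sio (_ : i = io) //; apply: val_inj.
rewrite /sphere_sum (bigID (top_pos j)) /=; congr (_ (+) _).
rewrite (reindex_inj (inv_inj oppvK)) /=; apply: eq_big => s; last first.
  by rewrite flag_sum_opp.
have fE : full j.+1 (oppv s) = full j.+1 s.
  by apply: eq_forallb => i; rewrite ffunE; case: (s i).
rewrite fE; case: (boolP (full j.+1 s)) => // /fullP fs /=.
by rewrite !topE ffunE; have := fs io; rewrite ltnSn; case: (s io) => [[]|].
Qed.

Lemma hemisphere_sumD j f g :
  hemisphere_sum j (fun sigma => f sigma (+) g sigma) =
  hemisphere_sum j f (+) hemisphere_sum j g.
Proof. by rewrite -big_split; apply: eq_bigr => s _; rewrite flag_sumD. Qed.

Lemma eq_hemisphere_sum j f g : (j < N)%N ->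
  (forall sigma, size sigma = j.+1 -> chainv sigma -> f sigma = g sigma) ->
  hemisphere_sum j f = hemisphere_sum j g.
Proof.
move=> jN fg; apply: eq_bigr => s /andP[fs _]; apply: eq_flag_sum => //.
by rewrite (card_full jN fs).
Qed.

Lemma hemisphere_sum_ex j f : (j < N)%N -> hemisphere_sum j f ->
  exists sigma, [/\ size sigma = j.+1, chainv sigma & f sigma].
Proof.
move=> jN H; apply/not_existsP => nex.
suff E0 : hemisphere_sum j f = false by rewrite E0 in H.
apply: big1 => s /andP[fs _]; apply/negP => /flag_sum_ex.
by rewrite (card_full jN fs) => /(_ (leqnn _)) [sigma /nex].
Qed.

Lemma sphere_sum0 f : sphere_sum 0 f = f [::].
Proof.
rewrite /sphere_sum (big_pred1 zerov) // => s.
apply/fullP/eqP => [fs|-> i]; last by rewrite ffunE.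
by apply/ffunP => i; rewrite ffunE; have := fs i; case: (s i).
Qed.

(** By [hits_origin_boundary] the count is that of ray hits on the equator, a union of two antipodal
    hemispheres. By oddness these are the hits of two opposite rays on one hemisphere, which
    [hits_origin_split] turns into the count for the preceding [j]. *)
Lemma generic_borsuk_ulam (R : realFieldType) (y : signvec -> nat -> R) :
  (forall s k, y (oppv s) k = - y s k) ->
  (forall sigma, chainv sigma -> (size sigma < N)%N ->
     indep (size sigma) (fun i => y (nth zerov sigma i))) ->
  forall j, (j < N)%N ->
  hemisphere_sum j
    (fun sigma => `[< hits_origin j j.+1 (fun i => y (nth zerov sigma i)) >]).
Proof.
move=> y_odd y_gen; elim=> [|j IHj] jN.
  (* Without coordinates every vertex hits the origin; as a coboundary, the count reduces to the
     empty simplex. *)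
  rewrite (@eq_hemisphere_sum _ _ (boundary_sum (fun=> true))) //.
    by rewrite hemisphere_boundary // sphere_sum0.
  case=> // s [|//] _ _ /=; apply/asboolT.
  by exists (fun=> 1); split => //; exists 0%N.
pose ray sigma := `[< hits_ray j j.+1 (fun i => y (nth zerov sigma i)) >].
have yE i sigma : (i < size sigma)%N -> (fun r => y (nth zerov (del i sigma) r)) =
    (fun i => y (nth zerov sigma i)) \o bump i.
  by move=> lt_i; apply: funext => r; rewrite /= nth_del.
rewrite (@eq_hemisphere_sum _ _ (boundary_sum ray)) // => [|sigma szs chs].
  rewrite hemisphere_boundary // sphere_hemisphere ?(ltnW jN) //.
  rewrite -hemisphere_sumD; apply: etrans (IHj (ltnW jN)).
  apply: eq_hemisphere_sum => [|sigma szs chs]; first exact: ltnW.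
  rewrite [RHS]hits_origin_split; last by rewrite -szs; apply: y_gen => //; rewrite szs.
  congr (_ (+) _); rewrite /ray; congr asbool; congr hits_ray.
  apply: funext => i; apply: funext => k; rewrite -y_odd.
  case: (ltnP i (size sigma)) => lt_i; first by rewrite (nth_map zerov).
  by rewrite !nth_default ?size_map ?oppv0.
have gen1 i : (i < j.+2)%N -> indep j.+1 (fun r => y (nth zerov (del i sigma) r)).
  move=> lt_i; have szd : size (del i sigma) = j.+1 by rewrite size_del szs.
  rewrite -szd; apply: y_gen; last by rewrite szd.
  exact: chainv_subseq (del_subseq _ _) chs.
rewrite hits_origin_boundary => [|i lt_i|i i' lt_i lt_i'].
- rewrite boundary_sumE szs; apply: eq_bigr => i _.
  by rewrite /ray yE // szs.
- by rewrite -yE ?szs //; apply: gen1.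
- have szd : size (del i sigma) = j.+1 by rewrite size_del szs.
  have szd' : size (del i' (del i sigma)) = j by rewrite size_del szd.
  have -> : ((fun i0 : nat => y (nth zerov sigma i0)) \o bump i) \o bump i' =
     fun r => y (nth zerov (del i' (del i sigma)) r).
    by apply: funext => r; rewrite /= !nth_del ?szd ?szs.
  rewrite -{1}szd'; apply: y_gen; last by rewrite szd' ltnW.
  apply: chainv_subseq (del_subseq _ _) _.
  exact: chainv_subseq (del_subseq _ _) chs.
Qed.
End SignVectors.

(** * The Borsuk-Ulam theorem for odd piecewise linear maps *)

(** There are fewer than [size p] roots, so one of the [size p] distinct points [e / (i + 2)] is not
    a root. *)
Lemma small_nonroot (R : realFieldType) (p : {poly R}) (e : R) :
  p != 0 -> 0 < e -> exists2 t, 0 < t < e & ~~ root p t.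
Proof.
move=> p0 e0; pose f (i : nat) := e / i.+2%:R.
have f_inj : injective f.
  move=> i i' /(mulfI (lt0r_neq0 e0)) /invr_inj /eqP.
  by rewrite eqr_nat => /eqP [].
have : ~~ all (root p) (map f (iota 0 (size p))).
  apply/negP => /(max_poly_roots p0); rewrite map_inj_uniq // iota_uniq => /(_ isT).
  by rewrite size_map size_iota ltnn.
move=> /allPn [_ /mapP[i _ ->] nr]; exists (f i) => //.
rewrite divr_gt0 ?ltr0n //= ltr_pdivrMr ?ltr0n // -[X in X < _]mulr1.
by rewrite ltr_pM2l // ltr1n.
Qed.

Lemma finite_nonroots (R : realFieldType) (I : finType) (Q : I -> R -> Prop) :
  (forall i, exists2 p : {poly R}, p != 0 & forall t, ~~ root p t -> Q i t) ->
  exists2 p : {poly R}, p != 0 & forall t, ~~ root p t -> forall i, Q i t.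
Proof.
move=> H; have /choice [p Hp] : forall i, exists p : {poly R},
    p != 0 /\ forall t, ~~ root p t -> Q i t.
  by move=> i; have [p] := H i; exists p.
exists (\prod_i p i) => [|t nr i]; first by apply/prodf_neq0 => i _; case: (Hp i).
apply: (Hp i).2; apply: contra nr => /rootP ri.
by apply/rootP; rewrite horner_prod (bigD1 i) //= ri mul0r.
Qed.

(** If [W + t Z] kills a nonzero row vector, then [t] is an eigenvalue of [- W Z^-1]; the
    characteristic polynomial of this matrix is the required one. *)
Lemma indep_perturbation (R : realFieldType) n (w z : nat -> nat -> R) :
  \matrix_(i < n, k < n) z i k \in unitmx ->
  exists2 p : {poly R}, p != 0 &
    forall t, ~~ root p t -> indep n (fun i k => w i k + t * z i k).
Proof.
set Z := \matrix_(i, k) _ => Zu; pose W : 'M[R]_n := \matrix_(i, k) w i k.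
exists (char_poly (- (W *m invmx Z))); first exact: monic_neq0 (char_poly_monic _).
move=> t; rewrite -eigenvalue_root_char => /eigenvalueP nev l l0.
pose u : 'rV[R]_n := \row_i l i.
have uE : u *m W + t *: (u *m Z) = 0.
  apply/rowP => k; rewrite !mxE; apply/etrans/(l0 k (ltn_ord k)); rewrite mulr_sumr -big_split /=.
  by apply: eq_bigr => i _; rewrite !mxE; ring.
have u0 : u = 0.
  apply/eqP/negPn/negP => un0; apply: nev; exists u => //.
  rewrite mulmxN mulmxA -[RHS](mulmxK Zu) -scalemxAl -mulNmx; congr (_ *m _).
  by apply/eqP; rewrite eq_sym -addr_eq0 addrC uE.
move=> i lt_i; have /rowP/(_ (Ordinal lt_i)) := u0.
by rewrite !mxE.
Qed.

Section BorsukUlam.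
Variables (R : realFieldType) (N : nat).
Local Notation signvec := (signvec N.+1).

Definition signv (s : signvec) : R :=
  if [pick i | s i != None] is Some i then (if s i == Some true then 1 else -1)
  else 0.

Lemma signv_opp s : signv (oppv s) = - signv s.
Proof.
rewrite /signv (@eq_pick _ _ [pred i | s i != None]); last first.
  by move=> i; rewrite /= ffunE; case: (s i).
case: pickP => [i /=|_]; last by rewrite oppr0.
by rewrite ffunE; case: (s i) => [[]|] //=; rewrite opprK.
Qed.

Lemma signv_neq0 s : s != zerov _ -> signv s != 0.
Proof.
move=> s0; rewrite /signv; case: pickP => [i _|sN].
  by case: ifP; rewrite ?oppr_eq0 oner_eq0.
case/eqP: s0; apply/ffunP => i; rewrite ffunE.
by have := sN i => /negbFE/eqP.
Qed.

(** A point of the moment curve, with a sign making it odd. Support sizes are distinct along a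
    chain, which leads to an invertible Vandermonde matrix. *)
Definition moment (s : signvec) k : R := signv s * #|supp s|%:R ^+ k.

Lemma moment_generic sigma : chainv sigma ->
  \matrix_(i < size sigma, k < size sigma) moment (nth (zerov _) sigma i) k
    \in unitmx.
Proof.
move=> /andP[so z0]; set n := size sigma.
pose d : 'rV[R]_n := \row_i signv (nth (zerov _) sigma i).
pose a : 'rV[R]_n := \row_i #|supp (nth (zerov _) sigma i)|%:R.
rewrite (_ : \matrix_(i, k) _ = diag_mx d *m (Vandermonde n a)^T); last first.
  by apply/matrixP => i k; rewrite mul_diag_mx !mxE.
rewrite unitmx_mul unitmx_tr !unitmxE !unitfE det_diag det_Vandermonde.
apply/andP; split.
  apply/prodf_neq0 => i _; rewrite mxE; apply: signv_neq0.
  by apply: contraNneq z0 => <-; rewrite mem_nth.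
apply/prodf_neq0 => i _; apply/prodf_neq0 => k ik.
rewrite !mxE subr_eq0 eqr_nat neq_ltn.
by rewrite supp_ltv //; apply: (sorted_ltn_nth (@ltv_trans _)); rewrite ?inE.
Qed.

(** Otherwise Gordan's theorem gives, for each chain of size [N.+1], a form positive on its image.
    These finitely many inequalities survive a small perturbation along [moment] that puts [y] in
    general position, against [generic_borsuk_ulam]. *)
Lemma borsuk_ulam (y : signvec -> nat -> R) :
  (forall s k, y (oppv s) k = - y s k) ->
  exists2 sigma, chainv sigma &
    hits_origin N (size sigma) (fun i => y (nth (zerov _) sigma i)).
Proof.
move=> y_odd; apply/not_exists2P => nhit.
have sep (x : (N.+1).-tuple signvec) : exists l : 'I_N -> R, chainv x ->
    forall i : 'I_N.+1, 0 < \sum_k l k * y (nth (zerov _) x i) k.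
  have [chx|//] := boolP (chainv x); last by exists (fun=> 0).
  have [[l Hl]|[c [c0 [i ci] cs]]] :=
    gordan (fun (i : 'I_N.+1) (k : 'I_N) => y (nth (zerov _) x i) k).
    by exists l.
  have [nch|nh] := nhit x; first by rewrite chx in nch.
  case: nh; rewrite size_tuple; exists (fun i => c (inord i)); split.
  - by move=> r _; apply: c0.
  - by exists i => //; rewrite inord_val.
  - move=> k lt_k; rewrite -[RHS](cs (Ordinal lt_k)); apply: eq_bigr => r _.
    by rewrite inord_val.
have [L HL] := choice sep.
pose pairing (u : signvec -> nat -> R) (xi : (N.+1).-tuple signvec * 'I_N.+1) :=
  \sum_k L xi.1 k * u (nth (zerov _) xi.1 xi.2) k.
have [|e e0 He] := @small_perturbation _ _
    (enum [pred xi : (N.+1).-tuple signvec * 'I_N.+1 | chainv xi.1])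
    (pairing y) (pairing moment).
  by move=> [x i]; rewrite mem_enum => chx; apply: HL.
have [|p p0 Hp] := @finite_nonroots R {j : 'I_N.+1 & j.-tuple signvec}
    (fun x t => chainv (tagged x) -> indep (size (tagged x))
       (fun i k => y (nth (zerov _) (tagged x) i) k
                   + t * moment (nth (zerov _) (tagged x) i) k)).
  move=> x; case: (boolP (chainv (tagged x))) => [chx|_]; last first.
    by exists 1; rewrite ?oner_eq0.
  have [p p0 Hp] := @indep_perturbation R _ (fun i => y (nth (zerov _) (tagged x) i))
    (fun i => moment (nth (zerov _) (tagged x) i)) (moment_generic chx).
  by exists p => // t /Hp H _.
have [t t_small /Hp tgen] := small_nonroot p0 e0.
pose y' s k := y s k + t * moment s k.
have y'_odd s k : y' (oppv s) k = - y' s k.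
  by rewrite /y' y_odd /moment signv_opp supp_oppv; ring.
have y'_gen sigma : chainv sigma -> (size sigma < N.+1)%N ->
    indep (size sigma) (fun i => y' (nth (zerov _) sigma i)).
  move=> chs lt_s; exact: (tgen (existT (fun j : 'I_N.+1 => j.-tuple signvec)
    (Ordinal lt_s) (in_tuple sigma))).
have /(hemisphere_sum_ex (ltnSn N)) := generic_borsuk_ulam y'_odd y'_gen (ltnSn N).
move=> [sigma [szs chs /asboolP [l [l0 [i lt_i li] lk]]]].
pose x : (N.+1).-tuple signvec := tcast szs (in_tuple sigma).
have xE : x = sigma :> seq _ by rewrite val_tcast.
have pos (r : 'I_N.+1) : 0 < \sum_k L x k * y' (nth (zerov _) sigma r) k.
  have := He _ t_small (x, r); rewrite mem_enum inE /= xE => /(_ chs).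
  rewrite /pairing /= xE mulr_sumr -big_split /=; congr (_ < _).
  by apply: eq_bigr => k _; rewrite /y'; ring.
have : 0 < \sum_(r < N.+1) l r * \sum_k L x k * y' (nth (zerov _) sigma r) k.
  rewrite (bigD1 (Ordinal lt_i)) //= ltr_wpDr //; last by rewrite mulr_gt0 // (pos (Ordinal _)).
  by apply: sumr_ge0 => r _; rewrite mulr_ge0 ?l0 // ltW.
under eq_bigr => r _ do rewrite mulr_sumr.
rewrite exchange_big big1 ?ltxx // => k _.
under eq_bigr => r _ do rewrite mulrCA.
by rewrite -mulr_sumr [X in _ * X](lk k (ltn_ord k)) mulr0.
Qed.
End BorsukUlam.

(** * Separating the rows and the columns of a matrix of points *)

Section Labelling.
Variable m : nat.
Implicit Types s t : signvec m.

Definition lead s : bool :=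
  if [pick i | s i != None] is Some i then s i == Some true else false.

(* The zero coordinates of [s], and the extra index [ord_max], are put on the
   side opposite to the leading sign; this makes the label of [s] a nontrivial
   bipartition of ['I_m.+1] if [s] is nonzero. *)
Definition label s (i : 'I_m.+1) : bool :=
  if unlift ord_max i is Some k then odflt (~~ lead s) (s k) else ~~ lead s.

Lemma lead_opp s : s != zerov m -> lead (oppv s) = ~~ lead s.
Proof.
move=> s0; rewrite /lead (@eq_pick _ _ [pred i | s i != None]); last first.
  by move=> i; rewrite /= ffunE; case: (s i).
case: pickP => [i /=|sN]; first by rewrite ffunE; case: (s i) => [[]|].
case/eqP: s0; apply/ffunP => i; rewrite ffunE.
by have := sN i => /negbFE/eqP.
Qed.

Lemma label_opp s i : s != zerov m -> label (oppv s) i = ~~ label s i.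
Proof.
move=> s0; rewrite /label lead_opp //; case: unliftP => // k _.
by rewrite ffunE; case: (s k).
Qed.

Lemma lead_pure s b : s != zerov m -> (forall i, s i != Some (~~ b)) -> lead s = b.
Proof.
move=> s0 nb; rewrite /lead; case: pickP => [i|sN].
  by have := nb i; case: (s i) => [[]|]; case: b {nb}.
case/eqP: s0; apply/ffunP => i; rewrite ffunE.
by have := sN i => /negbFE/eqP.
Qed.

(** A coordinate where the smallest nonzero member has sign [b] is labelled [b] throughout. For the
    label [~~ b], take a coordinate of that sign in the smallest member having one: members that
    vanish there have only signs [b], so their zeros are labelled [~~ b]. If no member has one,
    [ord_max] serves. *)
Lemma label_chain (S : pred (signvec m)) :
  (forall s t, S s -> S t -> facev s t \/ facev t s) ->
  exists i i', forall s, S s -> s != zerov m -> label s i && ~~ label s i'.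
Proof.
move=> tot; pose S0 s := S s && (s != zerov m).
case: (pickP S0) => [s0 S0s0|S00]; last first.
  by exists ord0, ord0 => s Ss snz; have := S00 s; rewrite /S0 Ss snz.
have [smin /andP[Smin smin0] smin_min] := arg_minnP (fun s => #|supp s|) S0s0.
have sub_of s t : S s -> S t -> (#|supp s| <= #|supp t|)%N -> facev s t.
  move=> Ss St st; case: (tot _ _ Ss St) => // ts.
  case: (eqVneq t s) => [->|nts]; first exact: facev_refl.
  by have := @supp_ltv _ s t; rewrite /ltv ts nts ltnNge st => /(_ isT).
have [k smink] : exists k, smin k != None.
  apply/existsP; apply: contraNT smin0; rewrite negb_exists => /forallP H.
  by apply/eqP/ffunP => k; rewrite ffunE; have := H k => /negPn/eqP.
case Ek : (smin k) smink => [b|//] _.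
have labk s : S s -> s != zerov m -> label s (lift ord_max k) = b.
  move=> Ss snz; have /facevP sub : facev smin s.
    by apply: sub_of => //; apply: smin_min; rewrite /S0 Ss.
  by rewrite /label liftK -sub Ek.
suff [k' labk'] : exists k', forall s, S s -> s != zerov m -> label s k' = ~~ b.
  case: (b) labk labk' {Ek} => labk labk'.
    by exists (lift ord_max k), k' => s Ss snz; rewrite labk ?labk'.
  by exists k', (lift ord_max k) => s Ss snz; rewrite labk ?labk'.
case: (pickP [pred s | S s && [exists i, s i == Some (~~ b)]]) => [s1 Hs1|pure].
  have [t /andP[St /existsP[k' /eqP tk']] t_min] := arg_minnP (fun s => #|supp s|) Hs1.
  exists (lift ord_max k') => s Ss snz; rewrite /label liftK.
  case Ek' : (s k') => [c|] /=.
    suff -> : c = ~~ b by [].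
    case: (tot _ _ Ss St) => /facevP /(_ k'); rewrite Ek' tk'.
      by move=> /(_ isT) [].
    by move=> /(_ isT) [].
  rewrite (@lead_pure s b) // => i; apply/negP => si.
  have /facevP/(_ k') : facev t s.
    apply: sub_of => //; apply: t_min; rewrite inE Ss /=; by apply/existsP; exists i.
  by rewrite tk' Ek' => /(_ isT).
exists ord_max => s Ss snz; rewrite /label unlift_none (@lead_pure s b) // => i.
apply/negP => si; have := pure s; rewrite inE Ss /= => /existsP; apply.
by exists i.
Qed.
End Labelling.

Section TwoFamilies.
Variable R : realFieldType.

Definition dot n (l x : 'I_n -> R) : R := \sum_k l k * x k.

Lemma dotB n (l l' x : 'I_n -> R) : dot (fun k => l k - l' k) x = dot l x - dot l' x.
Proof. by rewrite /dot -sumrB; apply: eq_bigr => k _; rewrite mulrBl. Qed.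

Definition separates n m (J : Type) (x : 'I_m.+1 -> J -> 'I_n -> R)
    (l : 'I_n -> R) (A : 'I_m.+1 -> bool) : Prop :=
  forall i i' j j', A i -> ~~ A i' -> dot l (x i' j') < dot l (x i j).

(** The labels of [s] and [oppv s] are complementary, so the difference of their separating forms
    still separates, and it is odd in [s]. *)
Lemma odd_separation n m (J : Type) (x : 'I_m.+1 -> J -> 'I_n -> R) :
  (forall A, exists l, separates x l A) ->
  exists rho : signvec m -> 'I_n -> R,
    (forall s k, rho (oppv s) k = - rho s k) /\
    (forall s, s != zerov m -> separates x (rho s) (label s)).
Proof.
move=> sep; have [tau Htau] := choice (fun s => sep (label s)).
exists (fun s k => tau s k - tau (oppv s) k); split=> [s k|s s0 i i' j j' Ai Ai'].
  by rewrite oppvK opprB.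
rewrite !dotB ltrD // ?Htau // ltrN2.
by apply: Htau; rewrite label_opp ?negbK.
Qed.

(** [label_chain] gives two rows on opposite sides for all nonzero members of the chain at once, so
    a nonnegative combination of their forms orders these rows, strictly if some nonzero member has
    positive weight. *)
Lemma chain_separation n m (J : Type) (x : 'I_m.+1 -> J -> 'I_n -> R)
    (rho : signvec m -> 'I_n -> R) q (s : 'I_q -> signvec m) (c : 'I_q -> R) :
  (forall s, s != zerov m -> separates x (rho s) (label s)) ->
  (forall k, rho (zerov m) k = 0) ->
  (forall p p', facev (s p) (s p') \/ facev (s p') (s p)) ->
  (forall p, 0 <= c p) ->
  exists i i', forall j j',
    \sum_p c p * dot (rho (s p)) (x i' j') <= \sum_p c p * dot (rho (s p)) (x i j)
      ?= iff ~~ [exists p, (0 < c p) && (s p != zerov m)].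
Proof.
move=> sep rho0 tot c0.
have [|i [i' lab]] := @label_chain m (fun t => [exists p, t == s p]).
  by move=> _ _ /existsP[p /eqP->] /existsP[p' /eqP->].
exists i, i' => j j'.
have labP p : s p != zerov m -> dot (rho (s p)) (x i' j') < dot (rho (s p)) (x i j).
  move=> sp; have Sp : [exists p', s p == s p'] by apply/existsP; exists p.
  by have /andP[Ai Ai'] := lab _ Sp sp; apply: sep.
have dot0 y : dot (rho (zerov m)) y = 0 :> R.
  by rewrite /dot big1 // => k _; rewrite rho0 mul0r.
rewrite negb_exists; apply: leif_sum => p _; apply/leifP; rewrite negb_and -leNgt.
have [->|sp] := eqVneq (s p) (zerov m); first by rewrite orbT !dot0.
rewrite orbF; case: ifPn => [cp|]; last by rewrite -ltNge => cp; rewrite ltr_pM2l ?labP.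
have -> : c p = 0 by apply/eqP; rewrite eq_le cp c0.
by rewrite !mul0r.
Qed.

Lemma two_families_separation n m (x : 'I_m.+2 -> 'I_m.+2 -> 'I_n -> R) :
  (n <= m + m.+1)%N ->
  (forall A, exists l, separates x l A) ->
  (forall A, exists l, separates (fun j i => x i j) l A) -> False.
Proof.
move=> le_n /odd_separation [rho [rhoN rho_sep]] /odd_separation [kap [kapN kap_sep]].
have odd0 (u : signvec m.+1 -> 'I_n -> R) :
    (forall s k, u (oppv s) k = - u s k) -> forall k, u (zerov _) k = 0.
  move=> uN k; have := uN (zerov _) k; rewrite oppv0 => /eqP.
  by rewrite -addr_eq0 -mulr2n mulrn_eq0 /= => /eqP.
(* The two halves of a sign vector present the sphere as a join of two spheres. The map [y] is
   padded with 0 beyond coordinate [n]. *)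
pose lp (s : signvec (m.+1 + m.+1)) : signvec m.+1 := [ffun i => s (lshift _ i)].
pose rp (s : signvec (m.+1 + m.+1)) : signvec m.+1 := [ffun i => s (rshift _ i)].
pose y (s : signvec (m.+1 + m.+1)) k : R :=
  if insub k is Some o then rho (lp s) o + kap (rp s) o else 0.
have [|sigma chs [c [c0 [p0 lt_p0 cp0] ck]]] := @borsuk_ulam R (m + m.+1) y.
  move=> s k; rewrite /y; case: insubP => [k0 _ _|_]; last by rewrite oppr0.
  have -> : lp (oppv s) = oppv (lp s) by apply/ffunP => i; rewrite !ffunE.
  have -> : rp (oppv s) = oppv (rp s) by apply/ffunP => i; rewrite !ffunE.
  by rewrite rhoN kapN opprD.
pose sg (p : 'I_(size sigma)) := nth (zerov _) sigma p.
have tot p p' : facev (sg p) (sg p') \/ facev (sg p') (sg p).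
  have /andP[so _] := chs.
  have lt_sub (r r' : 'I_(size sigma)) : (r < r')%N -> facev (sg r') (sg r).
    move=> rr'; suff /andP[] : ltv (sg r) (sg r') by [].
    by apply: (sorted_ltn_nth (@ltv_trans _)); rewrite ?inE.
  case: (ltngtP p p') => [/lt_sub|/lt_sub|/val_inj ->]; [by right|by left|].
  by left; apply: facev_refl.
have totl p p' : facev (lp (sg p)) (lp (sg p')) \/ facev (lp (sg p')) (lp (sg p)).
  by case: (tot p p') => /facevP H; [left|right]; apply/facevP => i;
    rewrite !ffunE => /H.
have totr p p' : facev (rp (sg p)) (rp (sg p')) \/ facev (rp (sg p')) (rp (sg p)).
  by case: (tot p p') => /facevP H; [left|right]; apply/facevP => i;
    rewrite !ffunE => /H.
pose cc (p : 'I_(size sigma)) := c p.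
have cc0 p : 0 <= cc p by exact: c0.
have [i [i' Hi]] := chain_separation rho_sep (odd0 _ rhoN) totl cc0.
have [j [j' Hj]] := chain_separation kap_sep (odd0 _ kapN) totr cc0.
have sum0 a b : \sum_p cc p * dot (rho (lp (sg p))) (x a b)
              + \sum_p cc p * dot (kap (rp (sg p))) (x a b) = 0.
  rewrite -big_split /=.
  under eq_bigr => p _ do rewrite -mulrDr /dot -big_split /= mulr_sumr.
  rewrite exchange_big big1 // => k _ /=.
  under eq_bigr => p _ do rewrite -mulrDl mulrA.
  rewrite -mulr_suml; have := ck k (leq_trans (ltn_ord k) le_n).
  rewrite /comb /y valK => E; rewrite [X in X * _](_ : _ = 0) ?mul0r //.
(* The two sums are opposite at every entry, and neither decreases from [(i', j')] to [(i, j)], so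
   both are constant there. The equality cases make both halves of the member [p0] of positive
   weight vanish. *)
have [le1 eq1] := Hi j j'; have [le2 eq2] := Hj i i'.
set a := \sum_p _ in le1 eq1; set a' := (X in a <= X) in le1 eq1.
set b := \sum_p _ in le2 eq2; set b' := (X in b <= X) in le2 eq2.
have E' : a + b = 0 by exact: sum0.
have E : a' + b' = 0 by exact: sum0.
have aa' : a == a' by apply/eqP/le_anti; lra.
have bb' : b == b' by apply/eqP/le_anti; lra.
move: eq1 eq2; rewrite aa' bb' => /esym/existsPn/(_ (Ordinal lt_p0)) lp0.
move=> /esym/existsPn/(_ (Ordinal lt_p0)); move: lp0.
rewrite !negb_and cp0 /= !negbK => /eqP/ffunP lp0 /eqP/ffunP rp0.
have /negP := (andP chs).2; apply; apply/(nthP (zerov _)); exists p0 => //.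
apply/ffunP => k; rewrite ffunE.
case: (split_ordP (k : 'I_(m.+1 + m.+1))) => k' ->.
  by have := lp0 k'; rewrite !ffunE.
by have := rp0 k'; rewrite !ffunE.
Qed.
End TwoFamilies.

(** * Transversals *)

Local Open Scope classical_set_scope.

Lemma subspace_of_dim (K : fieldType) (vT : vectType K) (U : {vspace vT}) j :
  (\dim U <= j <= dim vT)%N -> exists2 V, (U <= V)%VS & \dim V = j.
Proof.
elim: j => [|j IHj] /andP[].
  by rewrite leqn0 => /eqP U0 _; exists U.
rewrite leq_eqVlt => /orP[/eqP Uj _|]; first by exists U.
rewrite ltnS => Uj lt_j; have [|V UV dV] := IHj; first by rewrite Uj ltnW.
have /subvPn[v _ vV] : ~~ ({:vT} <= V)%VS.
  by apply: contraTN lt_j => /dimvS; rewrite dimvf dV -leqNgt.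
exists (V + <[v]>)%VS; first exact: subv_trans UV (addvSl _ _).
have v0 : v != 0 by apply: contraNneq vV => ->; rewrite mem0v.
rewrite dimv_disjoint_sum ?dV ?dim_vline ?v0 ?addn1 //.
apply/eqP; rewrite -subv0; apply/subvP => w; rewrite memv_cap memv0.
move=> /andP[wV /vlineP[a wE]]; rewrite wE scaler_eq0 (negPf v0) orbF.
apply: contraNT vV => a0.
by rewrite -[v](scalerK a0) -wE memvZ.
Qed.

Lemma dim_rV (K : fieldType) n : dim 'rV[K]_n = n.
Proof. by rewrite dim_matrix; apply: mul1n. Qed.

(** With [c i0] nonzero, [p i0] is in the affine span of the [m.+1] other points, whose direction is
    spanned by [m] differences and then enlarged to dimension exactly [m]. *)
Lemma flat_of_dependent (R : realType) n m (p : 'I_m.+2 -> 'rV[R]_n)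
    (c : 'I_m.+2 -> R) : (m <= n)%N ->
  \sum_i c i = 0 -> \sum_i c i *: p i = 0 -> (exists i, c i != 0) ->
  exists2 L, flat m L & forall i, L (p i).
Proof.
move=> mn c0 cp [i0 ci0]; pose b := lift i0 (ord0 : 'I_m.+1).
have bi0 : b != i0 by rewrite eq_sym neq_lift.
pose X := [seq p i - p b | i <- enum (predC (pred2 i0 b))].
have [|V XV dV] := @subspace_of_dim _ _ <<X>>%VS m.
  rewrite dim_rV mn andbT (leq_trans (dim_span _)) //.
  have c2 : #|pred2 i0 b| = 2%N by rewrite card2 eq_sym bi0.
  rewrite size_map -cardE -(leq_add2l #|pred2 i0 b|).
  by rewrite cardC card_ord c2.
exists [set p b + v | v in [set` V]]; first by exists (p b), V.
have pV i : i != i0 -> p i - p b \in V.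
  move=> ii0; have [->|ib] := eqVneq i b; first by rewrite subrr mem0v.
  apply: (subvP XV); apply/memv_span/map_f.
  by rewrite mem_enum !inE negb_or ii0.
move=> i; exists (p i - p b); last by rewrite addrC subrK.
rewrite /=; have [->|/pV //] := eqVneq i i0.
have /eqP : \sum_i c i *: (p i - p b) = 0.
  under eq_bigr => k _ do rewrite scalerBr.
  by rewrite sumrB cp -scaler_suml c0 scale0r subrr.
rewrite (bigD1 i0) //= addr_eq0 => /eqP E.
rewrite -[p i0 - p b](scalerK ci0) E memvZ // memvN.
by apply: memv_suml => k ki0; rewrite memvZ // pV.
Qed.

Lemma convex_combination (R : realType) n (K : set 'rV[R]_n) (J : eqType)
    (r : seq J) (c : J -> R) (x : J -> 'rV[R]_n) :
  convex_set K -> (forall j, K (x j)) -> (forall j, 0 <= c j) ->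
  0 < \sum_(j <- r) c j ->
  K ((\sum_(j <- r) c j)^-1 *: \sum_(j <- r) c j *: x j).
Proof.
move=> convK Kx c0; elim: r => [|a r IHr]; first by rewrite big_nil ltxx.
rewrite !big_cons; set S := \sum_(j <- r) c j => S_gt0.
have S0 : 0 <= S by apply: sumr_ge0.
have [SE|Sn0] := eqVneq S 0.
  have -> : \sum_(j <- r) c j *: x j = 0.
    rewrite big_seq big1 // => j jr; suff -> : c j = 0 by rewrite scale0r.
    apply/eqP; move: SE; rewrite /S => /eqP; rewrite psumr_eq0 // => /allP/(_ j jr).
    by [].
  rewrite SE !addr0 scalerA mulVf ?scale1r //.
  by move: S_gt0; rewrite SE addr0 => /lt0r_neq0.
have S_pos : 0 < S by rewrite lt_neqAle eq_sym Sn0.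
have t0 : 0 <= c a / (c a + S) by rewrite divr_ge0 // ltW.
have t1 : c a / (c a + S) <= 1 by rewrite ler_pdivrMr // mul1r lerDl.
have /set_mem := convK (x a) (S^-1 *: \sum_(j <- r) c j *: x j) (Itv01 t0 t1)
  (mem_set (Kx a)) (mem_set (IHr S_pos)).
congr K; rewrite /conv /= scalerDr !scalerA mulrC; congr (_ + _ *: _).
rewrite /unstable.onem; field; apply/andP; split=> //; exact: lt0r_neq0 S_gt0.
Qed.

(** Gordan's theorem is applied to the points lifted by a coordinate 1 and signed by [A]. A
    nonnegative relation, grouped by rows, would be an affine dependence between points [p i] of the
    [K i], hence give a transversal. *)
Lemma separation_of_no_transversal (R : realType) n m (J : finType) (j0 : J)
    (K : 'I_m.+2 -> set 'rV[R]_n) (x : 'I_m.+2 -> J -> 'rV[R]_n) :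
  (m <= n)%N -> (forall i, convex_set (K i)) -> (forall i j, K i (x i j)) ->
  ~ has_common_transversal m (range K) ->
  forall A, exists l, separates (fun i j k => x i j 0 k) l A.
Proof.
move=> mn convK Kx ntr A; pose sg i : R := if A i then 1 else -1.
pose xx i j (k : 'I_n.+1) := if unlift ord0 k is Some k' then x i j 0 k' else 1.
case: (gordan (fun (ij : 'I_m.+2 * J) k => sg ij.1 * xx ij.1 ij.2 k)) => [[l Hl]|].
  exists (fun k => l (lift ord0 k)) => i i' j j' Ai Ai'.
  have lE i1 j1 : \sum_k l k * (sg i1 * xx i1 j1 k) =
      sg i1 * (l ord0 + dot (fun k => l (lift ord0 k)) (fun k => x i1 j1 0 k)).
    rewrite big_ord_recl /xx unlift_none mulrDr /dot mulr_sumr; congr (_ + _).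
      by rewrite mulr1 mulrC.
    by apply: eq_bigr => k _; rewrite liftK; ring.
  have := Hl (i, j); have := Hl (i', j'); rewrite !lE /sg /= Ai (negPf Ai').
  by move=> *; lra.
move=> [c [c0 [[i1 j1] /= c1] cs]]; case: ntr.
pose La i := \sum_j c (i, j).
have La0 i : 0 <= La i by apply: sumr_ge0.
(* A row of total weight 0 contributes nothing, so any of its points will do. *)
pose p i := if La i == 0 then x i j0 else (La i)^-1 *: \sum_j c (i, j) *: x i j.
have Kp i : K i (p i).
  rewrite /p; case: eqP => // /eqP Lai.
  apply: (@convex_combination _ _ _ _ _ (fun j => c (i, j)) (x i)) => //.
  by rewrite -/(La i) lt_neqAle eq_sym Lai La0.
have Lap i : La i *: p i = \sum_j c (i, j) *: x i j.
  rewrite /p; case: eqP => [Lai|/eqP Lai]; last by rewrite scalerA divff ?scale1r.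
  rewrite Lai scale0r big1 // => j _; move/eqP: Lai; rewrite psumr_eq0 //.
  by move=> /allP/(_ j (mem_index_enum _))/eqP ->; rewrite scale0r.
have csE k : \sum_i sg i * \sum_j c (i, j) * xx i j k = 0.
  under eq_bigr => i _ do rewrite mulr_sumr.
  by rewrite pair_bigA -[RHS](cs k); apply: eq_bigr => -[i j] _ /=; ring.
have [||| L fL Lp] := @flat_of_dependent R n m p (fun i => sg i * La i) mn.
- rewrite -[RHS](csE ord0); apply: eq_bigr => i _; congr (_ * _).
  by apply: eq_bigr => j _; rewrite /xx unlift_none mulr1.
- apply/rowP => k; rewrite summxE [RHS]mxE -[RHS](csE (lift ord0 k)).
  apply: eq_bigr => i _; rewrite -scalerA Lap mxE summxE; congr (_ * _).
  by apply: eq_bigr => j _; rewrite /xx liftK mxE.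
- exists i1; rewrite mulf_neq0 //.
    by rewrite /sg; case: ifP; rewrite ?oppr_eq0 oner_eq0.
  rewrite gt_eqF // /La (bigD1 j1) //= ltr_wpDr //.
  exact: sumr_ge0.
exists L => // _ [i _ <-]; exists (p i); split; [exact: Lp|exact: Kp].
Qed.

Lemma two_families_transversal (R : realType) n m
    (K K' : 'I_m.+2 -> set 'rV[R]_n) :
  (m <= n <= m + m.+1)%N ->
  (forall i, convex_set (K i)) -> (forall i, convex_set (K' i)) ->
  (forall i j, K i `&` K' j !=set0) ->
  has_common_transversal m (range K) \/ has_common_transversal m (range K').
Proof.
move=> /andP[mn nm] convK convK' KK'.
have /choice [x Hx] : forall ij : 'I_m.+2 * 'I_m.+2, exists v, (K ij.1 `&` K' ij.2) v.
  by move=> [i j]; exact: KK'.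
apply: contrapT => /not_orP [ntr ntr'].
apply: (@two_families_separation R n m (fun i j k => x (i, j) 0 k)) => //.
- apply: (@separation_of_no_transversal R n m _ ord0 K (fun i j => x (i, j))) => //.
  by move=> i j; have [] := Hx (i, j).
- apply: (@separation_of_no_transversal R n m _ ord0 K' (fun j i => x (i, j))) => //.
  by move=> i j; have [] := Hx (j, i).
Qed.

(** * Reduction of the theorem to two families *)

Lemma has_common_transversal0 (R : realType) n j :
  (j <= n)%N -> has_common_transversal j (set0 : set (set 'rV[R]_n)).
Proof.
move=> jn; have [|V _ dV] := @subspace_of_dim R 'rV[R]_n 0%VS j.
  by rewrite dimv0 dim_rV.
by exists [set 0 + v | v in [set` V]] => //; exists 0, V.
Qed.

(** Since [k > 2], the inequality forces [q + 1 < p], so [2 (n - m) <= 2 ^ (q + 1) <= 2 ^ (p - 1) <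
    n]. *)
Lemma up_log_ineq_dim (k n m : nat) : (2 < k)%N ->
  (k * 2 ^ up_log 2 (n - m) + 2 <= 2 ^ up_log 2 n)%N -> (n < 2 * m)%N.
Proof.
move=> k_gt2; set q := up_log 2 (n - m); set p := up_log 2 n => kqp.
have nmq : (n - m <= 2 ^ q)%N by exact: up_logP.
have q_gt0 : (0 < 2 ^ q)%N by rewrite expn_gt0.
have qp : (2 ^ q.+1 < 2 ^ p)%N by rewrite expnS; nia.
have n_gt1 : (1 < n)%N.
  by rewrite ltnNge; apply/negP => n1; move: qp; rewrite /p; have : up_log 2 n = 0%N; [apply/eqP; rewrite up_log_eq0 n1 orbT|move=> ->; rewrite expnS; nia].
have pn : (2 ^ p.-1 < n)%N by exact: up_log_gtn.
rewrite ltn_exp2l // in qp.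
have : (2 ^ q.+1 <= 2 ^ p.-1)%N by rewrite leq_exp2l //; lia.
by rewrite expnS; lia.
Qed.

(* For x > 0, [up_log 2 x] is the ceiling of the base 2 logarithm of x; the
   hypotheses force 1 < n - m, so the truncated subtractions are exact. *)
Theorem theorem8p4 (R : realType) (n k : nat)
    (k_gt2 : (2 < k)%N) (k_small : (2 * k < n + 2)%N)
    (F : 'I_k -> set (set 'rV[R]_n))
    (F_convex : forall (i : 'I_k) (K : set 'rV[R]_n), F i K -> convex_set K)
    (F_compact : forall (i : 'I_k) (K : set 'rV[R]_n), F i K -> compact K)
    (m : nat) (m_gt0 : (0 < m)%N) (m_le : (m <= n - k + 1)%N)
    (log_ineq :
      (2 ^ up_log 2 n >= k * 2 ^ up_log 2 (n - m) + 2)%N) :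
  (exists K : 'I_k -> set 'rV[R]_n,
     (forall i : 'I_k, F i (K i)) /\ \bigcap_(i in [set: 'I_k]) K i = set0)
  \/
  (exists i : 'I_k, forall G : set (set 'rV[R]_n),
     G `<=` F i -> G #<= `I_m.+1 -> has_common_transversal (m - 1) G).
Proof.
have n_lt := @up_log_ineq_dim k n m k_gt2 log_ineq.
(* From here on [m] is the [m - 1] of the statement, so subfamilies have at most [m.+2] sets. *)
case: m m_gt0 m_le n_lt {log_ineq} => // m _ m_le n_lt; rewrite subn1 /=.
have mn : (m <= n)%N by lia.
apply: contrapT => /not_orP [no_empty no_transversal].
have /choice [G HG] : forall i, exists G, [/\ G `<=` F i, G #<= `I_m.+2 &
    ~ has_common_transversal m G].
  move=> i; apply/not_existsP => HG; apply: no_transversal; exists i => G GF Gm.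
  by apply: contrapT => nG; apply: (HG G).
have Gfam i : exists K : 'I_m.+2 -> set 'rV[R]_n, G i = range K.
  have [GF /pcard_surjP [g Gg] nG] := HG i.
  have [K0 GK0] : G i !=set0.
    apply/set0P/negP => /eqP G0; apply: nG; rewrite G0; exact: has_common_transversal0.
  (* The list may repeat sets; values of [g] outside [G i] are replaced by [K0]. *)
  exists (fun r : 'I_m.+2 => if pselect (G i (g r)) then g r else K0).
  apply/seteqP; split=> [K GK|_ [r _ <-]]; last by case: pselect.
  have [r lt_r grK] := Gg K GK; exists (Ordinal lt_r) => //=.
  by case: pselect => //; rewrite grK.
have /choice [K HK] := Gfam.
have FK i r : F i (K i r).
  by have [GF _ _] := HG i; apply: GF; rewrite HK; exists r.
pose i0 : 'I_k := Ordinal (ltnW (ltnW k_gt2)).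
pose i1 : 'I_k := Ordinal (ltnW k_gt2).
have [|||||] := @two_families_transversal R n m (K i0) (K i1).
- by rewrite mn; lia.
- by move=> r; apply: F_convex (FK i0 r).
- by move=> r; apply: F_convex (FK i1 r).
- move=> r r'; apply/set0P/negP => /eqP E; apply: no_empty.
  (* The sets at [i0] and [i1] are already disjoint; the other representatives are arbitrary. *)
  exists (fun i => if i == i0 then K i0 r else if i == i1 then K i1 r' else K i ord0).
  split=> [i|].
    by case: eqP => [->|_]; [|case: eqP => [->|_]]; exact: FK.
  rewrite -subset0 -E => v Hv; split.
    by have := Hv i0 I.
  by have := Hv i1 I.
- by rewrite -HK; have [] := HG i0.
- by rewrite -HK; have [] := HG i1.
Qed.
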